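(* Let $K$ be a tame, prime and alternating knot with a regular and common (alternating) projection, and let $\Re''$ be the rewriting system associated with this projection as defined in the context. Then $\Re''$ is terminating.
   Context: Projection. The projection $\wp(K)\subset\mathbb{R}^2$ is regular (finitely many multiple points, all transverse double points, called crossings; a 4-valent plane graph) and alternating. The domains are the components of $\mathbb{R}^2\setminus\wp(K)$, labelled $x_0,\dots,x_n$ with $x_0$ unbounded. It is common: the boundaries of two distinct domains have at most one edge in common, and each crossing is on the boundary of exactly four distinct domains. Prime knots are nontrivial, so there is at least one crossing. Write $\overline{x}$ for the formal inverse of $x$. At each crossing four domains $x_a,x_b,x_c,x_d$ meet in this cyclic order, labelled so that the overcrossing strand separates $x_a$ from $x_b$; the Dehn relator of the crossing is $x_a\overline{x_b}x_c\overline{x_d}$. Sources and sinks. Colour the domains like a chessboard (domains sharing an edge have different colours). Domains of the colour of $x_0$ are sources, the others are sinks. Rename $x_i$ as $s_i$ if it is a source and as $t_i$ if it is a sink. Up to inversion and cyclic permutation the relator of a crossing has the normalized form $s_i\overline{t_j}s_k\overline{t_l}$, unique up to exchanging $(i,j)$ with $(k,l)$. Neighbours of $x_0$. Call a sink $t_l$ outer if its domain shares an edge with $x_0$. By the hypotheses, for every outer $t_l$ there is exactly one crossing whose normalized relator is $s_0\overline{t_j}s_k\overline{t_l}$ for some $j,k$; put $\sigma(l)=j$, $\kappa(l)=k$ (then $t_{\sigma(l)}$ is again outer). For a sink $t_q$ let $T(q)$ be the word $\overline{t_{\sigma(q)}}\,s_{\kappa(q)}$ if $t_q$ is outer, and $t_q$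 otherwise. The system $\Re''$ on the alphabet $\{x_1,\dots,x_n,\overline{x_1},\dots,\overline{x_n}\}$ consists of the following rules. (0) $x_i\overline{x_i}\to1$ and $\overline{x_i}x_i\to1$ for $1\le i\le n$. For each outer $t_l$, with $j=\sigma(l)$, $k=\kappa(l)$, $l'=\sigma(j)$, $k'=\kappa(j)$: (1) $t_l\to\overline{t_j}s_k$; (2') $s_k\overline{t_l}\to\overline{t_{l'}}s_{k'}$; (3) $\overline{t_l}\,\overline{t_j}\to\overline{s_k}$; (4) $\overline{s_k}\,\overline{t_{l'}}\to\overline{t_l}\,\overline{s_{k'}}$. For each crossing not on the boundary of $x_0$ and each of the two ways of writing its normalized relator as $s_m\overline{t_p}s_{m'}\overline{t_q}$: (a) $s_m\overline{t_p}\to T(q)\,\overline{s_{m'}}$; (b) if $t_q$ is not outer: $\overline{s_m}t_q\to\overline{t_p}s_{m'}$; (5) if $t_q$ is outer: $\overline{s_m}\,\overline{t_{\sigma(q)}}\to\overline{t_p}s_{m'}\overline{s_{\kappa(q)}}$. Rewriting terminology. $ulv\to urv$ for each rule $l\to r$ and all words $u,v$. A system is terminating if there is no infinite sequence of reductions $w_1\to w_2\to\cdots\to w_n\to\cdots$. *)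

(* Defs.v *)
From mathcomp Require Import all_boot all_order all_algebra.
From mathcomp Require Import all_classical all_reals all_analysis.

Set Implicit Arguments.
Unset Strict Implicit.
Unset Printing Implicit Defensive.

Import Order.TTheory GRing.Theory Num.Theory.
Import numFieldNormedType.Exports.

Local Open Scope classical_set_scope.
Local Open Scope ring_scope.

(** * Knots *)

(** Euclidean 3-space is split as [plane * height], so that the projection onto
    the plane is [fst] and the height of a point above it is [snd]. *)
Notation plane R := (Real.sort R * Real.sort R)%type.
Notation space3 R := (Real.sort R * Real.sort R * Real.sort R)%type.

Definition homeomorphism (T : topologicalType) (f : T -> T) : Prop :=
  continuous f /\ exists g : T -> T, [/\ continuous g, cancel f g & cancel g f].

Definition boundary (T : topologicalType) (A : set T) : set T :=
  closure A `\` A°.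

Section Knots.
Variable R : realType.
Implicit Types (K L : set (space3 R)) (gamma : R -> space3 R).

(** The circle is R/Z. *)
Definition parametrizes gamma K : Prop :=
  [/\ continuous gamma,
      (forall s t : R, gamma s = gamma t <-> s - t \is a Num.int)
    & range gamma = K].

Definition knot K : Prop := exists gamma, parametrizes gamma K.

Definition ambient_isotopic K L : Prop :=
  exists H : R -> space3 R -> space3 R,
    [/\ {within [set q : R * space3 R | 0 <= q.1 <= 1],
           continuous (fun q : R * space3 R => H q.1 q.2)},
        (forall t : R, 0 <= t <= 1 -> homeomorphism (H t)),
        (forall x, H 0 x = x)
      & H 1 @` K = L].

Definition segment (a b : space3 R) : set (space3 R) :=
  [set x | exists t : R, 0 <= t <= 1 /\ x = (1 - t) *: a + t *: b].

Definition polygonal_knot K : Prop :=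
  knot K /\ exists e : seq (space3 R * space3 R),
    K = [set x | exists2 ab, ab \in e & segment ab.1 ab.2 x].

Definition tame K : Prop :=
  exists L, polygonal_knot L /\ ambient_isotopic K L.

Definition unit_circle : set (space3 R) :=
  [set x | x.1.1 ^+ 2 + x.1.2 ^+ 2 = 1 /\ x.2 = 0].

Definition trivial_knot K : Prop := ambient_isotopic K unit_circle.

(** [L] meets the plane x = 0 in two points only, which cut it into two arcs;
    closing each arc by the segment between the two points gives [L1] (in the
    half-space x <= 0) and [L2] (in x >= 0).  If both arcs of [L] were on the
    same side, [L1] or [L2] would be a mere segment and not a knot. *)
Definition knot_product L L1 L2 : Prop :=
  [/\ polygonal_knot L, polygonal_knot L1, polygonal_knot L2
    & exists a b : space3 R,
      [/\ a != b,
          L `&` [set x | x.1.1 = 0] = [set a; b],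
          L1 = (L `&` [set x | x.1.1 <= 0]) `|` segment a b
        & L2 = (L `&` [set x | 0 <= x.1.1]) `|` segment a b]].

Definition prime_knot K : Prop :=
  ~ trivial_knot K /\
  forall L L1 L2, ambient_isotopic K L -> knot_product L L1 L2 ->
    trivial_knot L1 \/ trivial_knot L2.

(** * Projections *)

Definition shadow K : set (plane R) := fst @` K.

Definition multiple_points K : set (plane R) :=
  [set P | exists x y, [/\ K x, K y, x != y, x.1 = P & y.1 = P]].

(** A transverse double point: in the plane coordinates [phi], a box around the
    point meets the projection exactly in the two axes, run through once each
    by the parameters near [s] (horizontal axis) and near [t] (vertical axis).
    The strand of [s] is the overcrossing one. *)
Definition crossing_chart gamma (s t e : R) (phi : plane R -> plane R) : Prop :=
  [/\ 0 < e, homeomorphism phi,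
      (forall u : R, `|u| < e ->
         phi (gamma (s + u)).1 = (u, 0) /\ phi (gamma (t + u)).1 = (0, u)),
      (forall w : R,
         `|(phi (gamma w).1).1| < e -> `|(phi (gamma w).1).2| < e ->
         exists2 u : R, `|u| < e &
           w - (s + u) \is a Num.int \/ w - (t + u) \is a Num.int)
    & (gamma t).2 < (gamma s).2].

Definition regular_projection gamma : Prop :=
  finite_set (multiple_points (range gamma)) /\
  forall P, multiple_points (range gamma) P ->
    exists s t e phi, crossing_chart gamma s t e phi /\ (gamma s).1 = P.

Definition overpass gamma (s : R) : Prop :=
  exists t : R, (gamma s).1 = (gamma t).1 /\ (gamma t).2 < (gamma s).2.

Definition underpass gamma (s : R) : Prop :=
  exists t : R, (gamma s).1 = (gamma t).1 /\ (gamma s).2 < (gamma t).2.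

Definition alternating_projection gamma : Prop :=
  forall s s' : R, s < s' ->
    (overpass gamma s -> overpass gamma s' ->
       exists2 u : R, s < u < s' & underpass gamma u) /\
    (underpass gamma s -> underpass gamma s' ->
       exists2 u : R, s < u < s' & overpass gamma u).

Definition domain_labelling K n (D : 'I_n.+1 -> set (plane R)) : Prop :=
  [/\ injective D,
      (forall i, exists2 z, ~ shadow K z &
         D i = connected_component (~` shadow K) z),
      (forall z, ~ shadow K z -> exists i, D i z)
    & ~ bounded_set (D ord0)].

(** Edges of the 4-valent plane graph, without their end points. *)
Definition edge K (E : set (plane R)) : Prop :=
  exists2 z, (shadow K `\` multiple_points K) z &
    E = connected_component (shadow K `\` multiple_points K) z.

Definition common_edge K (A B E : set (plane R)) : Prop :=
  [/\ edge K E, E `<=` boundary A & E `<=` boundary B].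

Definition common_projection K n (D : 'I_n.+1 -> set (plane R)) : Prop :=
  (forall i j, i != j -> forall E E' : set (plane R),
     common_edge K (D i) (D j) E -> common_edge K (D i) (D j) E' -> E = E') /\
  (forall P, multiple_points K P ->
     #|[pred i | `[< boundary (D i) P >]]| = 4%N).

Definition chessboard K n (D : 'I_n.+1 -> set (plane R))
    (col : 'I_n.+1 -> bool) : Prop :=
  forall i j, i != j -> (exists E, common_edge K (D i) (D j) E) ->
    col i != col j.

(** Domains at the crossing [P] in cyclic order; the overcrossing strand, being
    the horizontal axis of the chart, separates [D a] from [D b] and [D c] from
    [D d]. *)
Definition domains_at gamma n (D : 'I_n.+1 -> set (plane R)) (P : plane R)
    (a b c d : 'I_n.+1) : Prop :=
  exists s t e phi,
    [/\ crossing_chart gamma s t e phi /\ (gamma s).1 = P,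
        [set z | 0 < (phi z).1 < e /\ 0 < (phi z).2 < e] `<=` D a,
        [set z | 0 < (phi z).1 < e /\ - e < (phi z).2 < 0] `<=` D b,
        [set z | - e < (phi z).1 < 0 /\ - e < (phi z).2 < 0] `<=` D c
      & [set z | - e < (phi z).1 < 0 /\ 0 < (phi z).2 < e] `<=` D d].

End Knots.

(** * Words and rewriting *)

(** [(i, false)] is the generator x_i, [(i, true)] its formal inverse. *)
Definition letter (I : Type) : Type := (I * bool)%type.
Definition pos (I : Type) (i : I) : letter I := (i, false).
Definition bar (I : Type) (i : I) : letter I := (i, true).
Definition inv_word (I : Type) (w : seq (letter I)) : seq (letter I) :=
  rev [seq (x.1, ~~ x.2) | x <- w].

Definition reduction (A : Type) (rule : seq A -> seq A -> Prop)
    (w w' : seq A) : Prop :=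
  exists u v l r, [/\ rule l r, w = u ++ l ++ v & w' = u ++ r ++ v].

Definition terminating (A : Type) (rule : seq A -> seq A -> Prop) : Prop :=
  ~ exists w : nat -> seq A, forall i : nat, reduction rule (w i) (w i.+1).

Section System.
Variables (R : realType) (gamma : R -> space3 R) (n : nat).
Variables (D : 'I_n.+1 -> set (plane R)) (col : 'I_n.+1 -> bool).

Definition is_source (i : 'I_n.+1) : bool := col i == col ord0.
Definition is_sink (i : 'I_n.+1) : bool := ~~ is_source i.

Definition dehn_relator (P : plane R) (w : seq (letter 'I_n.+1)) : Prop :=
  exists a b c d, domains_at gamma D P a b c d /\
    w = [:: pos a; bar b; pos c; bar d].

Definition normalized_relator (P : plane R) (i j k l : 'I_n.+1) : Prop :=
  [/\ is_source i && is_source k, is_sink j && is_sink l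
    & exists2 w, dehn_relator P w &
      exists m : nat, let nf := [:: pos i; bar j; pos k; bar l] in
        nf = rot m w \/ nf = rot m (inv_word w)].

(** The alphabet of the system omits x_0: an index [i : 'I_n] stands for
    x_(i+1), i.e. for the domain [D (dom i)].  Nothing is lost by indexing the
    rules by ['I_n]: sinks differ from x_0, and in a common projection the four
    domains at a crossing are distinct. *)
Definition dom (i : 'I_n) : 'I_n.+1 := lift ord0 i.

Definition outer (l : 'I_n) : Prop :=
  is_sink (dom l) /\
  exists E, common_edge (range gamma) (D (dom l)) (D ord0) E.

(** j = sigma(l) and k = kappa(l).  For the diagrams under consideration each
    outer l has exactly one such pair (j, k), so the relation is the graph of the
    functions sigma and kappa; likewise [T_word] below is the graph of T. *)
Definition sigma_kappa (l j k : 'I_n) : Prop :=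
  outer l /\ exists P, normalized_relator P ord0 (dom j) (dom k) (dom l).

Definition T_word (q : 'I_n) (w : seq (letter 'I_n)) : Prop :=
  (exists j k, sigma_kappa q j k /\ w = [:: bar j; pos k]) \/
  (~ outer q /\ w = [:: pos q]).

Definition inner_relator (m p m' q : 'I_n) : Prop :=
  exists2 P, normalized_relator P (dom m) (dom p) (dom m') (dom q) &
    ~ boundary (D ord0) P.

Inductive rule_R'' : seq (letter 'I_n) -> seq (letter 'I_n) -> Prop :=
| rule0l i : rule_R'' [:: pos i; bar i] [::]
| rule0r i : rule_R'' [:: bar i; pos i] [::]
| rule1 l j k : sigma_kappa l j k ->
    rule_R'' [:: pos l] [:: bar j; pos k]
| rule2' l j k l' k' : sigma_kappa l j k -> sigma_kappa j l' k' ->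
    rule_R'' [:: pos k; bar l] [:: bar l'; pos k']
| rule3 l j k : sigma_kappa l j k ->
    rule_R'' [:: bar l; bar j] [:: bar k]
| rule4 l j k l' k' : sigma_kappa l j k -> sigma_kappa j l' k' ->
    rule_R'' [:: bar k; bar l'] [:: bar l; bar k']
| rule_a m p m' q w : inner_relator m p m' q -> T_word q w ->
    rule_R'' [:: pos m; bar p] (w ++ [:: bar m'])
| rule_b m p m' q : inner_relator m p m' q -> ~ outer q ->
    rule_R'' [:: bar m; pos q] [:: bar p; pos m']
| rule5 m p m' q j k : inner_relator m p m' q -> sigma_kappa q j k ->
    rule_R'' [:: bar m; bar j] [:: bar p; pos m'; bar k].

End System.

(* Main.v *)
Require Import Defs.
From mathcomp Require Import all_boot all_order all_algebra.
From mathcomp Require Import all_classical all_reals all_analysis.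
From mathcomp Require Import zify.

(** Interpret each letter as a strictly increasing map of the natural numbers, and
    a word as the composite of its letters, the leftmost acting first: [x + 1]
    for a source or its inverse, [3x + 3] for an outer sink, and [3x + 1] for any
    other sink and for the inverse of any sink.  Apart from the cancellations,
    with S, T, U letters of these three classes, every rule has one of the shapes
    U -> TS, ST -> TS, ST -> TSS, TT -> S, since no right-hand side contains an
    outer sink; all of them decrease the composite at every point.  Only the
    chessboard colours of the letters matter, not the plane geometry. *)

Lemma foldl_homo_ltn (A : Type) (f : nat -> A -> nat) (w : seq A) :
  (forall a, {homo f^~ a : x y / (x < y)%N}) ->
  {homo (fun x => foldl f x w) : x y / (x < y)%N}.
Proof.
by move=> f_incr; elim: w => //= a w IHw x y lt_xy; apply/IHw/f_incr.
Qed.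

(** The left context only moves the starting point, and monotonicity carries a decrease through the
    right context; an infinite reduction would give an infinite descent of the values at 0. *)
Lemma terminating_foldl (A : Type) (rule : seq A -> seq A -> Prop)
    (f : nat -> A -> nat) :
  (forall a, {homo f^~ a : x y / (x < y)%N}) ->
  (forall l r, rule l r -> forall x, (foldl f x r < foldl f x l)%N) ->
  terminating rule.
Proof.
move=> f_incr rule_decr [w w_red].
have decr i : (foldl f 0 (w i.+1) < foldl f 0 (w i))%N.
  have [u [v [l [r [lr -> ->]]]]] := w_red i.
  by rewrite !foldl_cat; apply/foldl_homo_ltn/rule_decr.
have bound i : (foldl f 0 (w i) + i <= foldl f 0 (w 0))%N.
  elim: i => [|i IHi]; first by rewrite addn0.
  by have := decr i; lia.
by have := bound (foldl f 0 (w 0)).+1; lia.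
Qed.

Section Weight.
Variables (R : realType) (gamma : R -> space3 R) (n : nat).
Variables (D : 'I_n.+1 -> set (plane R)) (col : 'I_n.+1 -> bool).

Definition weight (x : nat) (a : letter 'I_n) : nat :=
  if is_source col (dom a.1) then x.+1
  else if ~~ a.2 && `[< outer gamma D col a.1 >] then (3 * x + 3)%N
  else (3 * x + 1)%N.

Lemma weight_homo_ltn a : {homo weight^~ a : x y / (x < y)%N}.
Proof. by move=> x y; rewrite /weight; do 2?case: ifP => _; lia. Qed.

(** Settles the cancellation rules, whose right-hand side acts as the identity. *)
Lemma weight_gt x a : (x < weight x a)%N.
Proof. by rewrite /weight; do 2?case: ifP => _; lia. Qed.

Lemma sigma_kappa_colours l j k : sigma_kappa gamma D col l j k ->
  [/\ outer gamma D col l, is_source col (dom l) = false,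
      is_source col (dom j) = false & is_source col (dom k)].
Proof.
by case=> lo [P [/andP[_ ?] /andP[/negbTE ? /negbTE ?] _]].
Qed.

Lemma inner_relator_colours m p m' q : inner_relator gamma D col m p m' q ->
  [/\ is_source col (dom m), is_source col (dom p) = false,
      is_source col (dom m') & is_source col (dom q) = false].
Proof. by case=> P [/andP[? ?] /andP[/negbTE ? /negbTE ?] _]. Qed.

Lemma rule_R''_weight l r : rule_R'' gamma D col l r ->
  forall x, (foldl weight x r < foldl weight x l)%N.
Proof.
case=> {l r} [i|i|l j k|l j k l' k'|l j k|l j k l' k'|m p m' q w|m p m' q
             |m p m' q j k].
- by move=> x; apply: ltn_trans (weight_gt _ _); apply: weight_gt.
- by move=> x; apply: ltn_trans (weight_gt _ _); apply: weight_gt.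
- move=> /sigma_kappa_colours[l_outer lT jT kS] x.
  (* The constant 3 for outer sinks is just enough: 3x + 2 < 3x + 3. *)
  by rewrite /weight /= lT jT kS (asboolT l_outer); lia.
- move=> /sigma_kappa_colours[_ lT _ kS] /sigma_kappa_colours[_ _ l'T k'S] x.
  by rewrite /weight /= lT kS l'T k'S; lia.
- move=> /sigma_kappa_colours[_ lT jT kS] x.
  by rewrite /weight /= lT jT kS; lia.
- move=> /sigma_kappa_colours[_ lT _ kS] /sigma_kappa_colours[_ _ l'T k'S] x.
  by rewrite /weight /= lT kS l'T k'S; lia.
- move=> /inner_relator_colours[mS pT m'S qT].
  case=> [[j [k [/sigma_kappa_colours[_ _ jT kS] ->]]]|[q_inner ->]] x.
    by rewrite /weight /= mS pT m'S jT kS; lia.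
  (* An outer [q] would give 3x + 4 on both sides. *)
  by rewrite /weight /= mS pT m'S qT (asboolF q_inner); lia.
- move=> /inner_relator_colours[mS pT m'S qT] q_inner x.
  by rewrite /weight /= mS pT m'S qT (asboolF q_inner); lia.
- move=> /inner_relator_colours[mS pT m'S _] /sigma_kappa_colours[_ _ jT kS] x.
  (* Tight again: 3x + 3 < 3x + 4. *)
  by rewrite /weight /= mS pT m'S jT kS; lia.
Qed.

End Weight.

Theorem theorem5p4 (R : realType) (K : set (space3 R)) (gamma : R -> space3 R)
    (n : nat) (D : 'I_n.+1 -> set (plane R)) (col : 'I_n.+1 -> bool)
    (gammaK : parametrizes gamma K)
    (K_tame : tame K) (K_prime : prime_knot K)
    (proj_regular : regular_projection gamma)
    (proj_alternating : alternating_projection gamma)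
    (D_domains : domain_labelling K D)
    (proj_common : common_projection K D)
    (col_chessboard : chessboard K D col) :
  terminating (rule_R'' gamma D col).
Proof.
exact: terminating_foldl (@weight_homo_ltn _ gamma _ D col)
  (@rule_R''_weight _ gamma _ D col).
Qed.
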